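(* Let $G$ be a fundamental FHM-graph and let $\Pi_1,\dots,\Pi_p$ be all the (unordered) pairs of disjoint odd cycles of $G$. Suppose there is a choice of edges $b^1,\dots,b^p$ such that $b^i$ is a bridge of $\Pi_i$ for each $i$, satisfying: for each $i$, the even closed walk $E_i$ of $b^i$ in $\Pi_i$ contains at most $2$ edges belonging to $\{b^1,\dots,b^p\}\setminus\{b^i\}$, and the number of indices $i$ for which $E_i$ contains exactly $2$ edges of $\{b^1,\dots,b^p\}\setminus\{b^i\}$ is at most $2$. Then the edge polytope $P_G$ possesses a regular unimodular triangulation.
   Context: All graphs are finite, connected and simple (no loops, no multiple edges). Let $G$ have vertex set $\{1,\dots,d\}$ and edge set $E=\{e_1,\dots,e_n\}$. For an edge $e=\{i,j\}$ put $\rho(e)=\mathbf e_i+\mathbf e_j\in\mathbb Z^d$, where $\mathbf e_i$ is the $i$-th unit vector; the edge polytope $P_G\subset\mathbb R^d$ is the convex hull of $\{\rho(e): e\in E\}$. A regular unimodular triangulation of $P_G$ is a triangulation of $P_G$ by lattice simplices with vertices among the $\rho(e)$, all of normalized volume $1$, induced by a height function (lifting). Two odd cycles are disjoint if they have no common vertex. A bridge of a pair $(C,C')$ of disjoint odd cycles is an edge of $G$ with one endpoint on $C$ and the other on $C'$. An FHM-graph is a graph in which every pair of disjoint odd cycles has a bridge; a fundamental FHM-graph is an FHM-graph having at least one pair of disjoint odd cycles. For a bridge $b=\{u,v\}$ of $(C,C')$ with $u\in C$, $v\in C'$, the even closed walk of $b$ in $(C,C')$ is the closed walk obtained by traversing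 $C$ once starting and ending at $u$, then $b$ from $u$ to $v$, then traversing $C'$ once starting and ending at $v$, then $b$ back from $v$ to $u$. An edge is contained in the walk if it occurs in it. *)

(* Defs.v *)
From HB Require Import structures.
From mathcomp Require Import all_boot all_order all_algebra.
Set Implicit Arguments. Unset Strict Implicit. Unset Printing Implicit Defensive.
Import Order.TTheory GRing.Theory Num.Theory.

Section Graphs.
Variable T : finType.
Variable g : rel T.

Definition simple_connected : Prop :=
  [/\ symmetric g, irreflexive g & forall x y, connect g x y].

Definition edges : {set {set T}} :=
  [set e : {set T} | [exists x, exists y, g x y && (e == [set x; y])]].

Definition is_cycle_seq (s : seq T) : bool :=
  [&& uniq s, 2 < size s & cycle g s].

Definition cycle_edges (s : seq T) : {set {set T}} :=
  [set [set x.1; x.2] | x in zip s (rot 1 s)].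

(* C (as an edge set, i.e. a subgraph) is an odd cycle of g.  A duplicate-free
   sequence has length at most #|T|, hence the bounded quantification. *)
Definition odd_cycle (C : {set {set T}}) : bool :=
  [exists n : 'I_#|T|.+1, exists t : n.-tuple T,
     [&& is_cycle_seq t, odd n & C == cycle_edges t]].

Definition cycle_vertices (C : {set {set T}}) : {set T} := \bigcup_(e in C) e.

Definition disjoint_odd_cycles (C C' : {set {set T}}) : bool :=
  [&& odd_cycle C, odd_cycle C' & [disjoint cycle_vertices C & cycle_vertices C']].

Definition is_bridge (C C' : {set {set T}}) (b : {set T}) : bool :=
  (b \in edges) &&
  [exists u, exists v, [&& u \in cycle_vertices C, v \in cycle_vertices C' & b == [set u; v]]].

Definition FHM : Prop :=
  forall C C', disjoint_odd_cycles C C' -> exists b, is_bridge C C' b.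

Definition fundamental_FHM : Prop :=
  FHM /\ exists C C', disjoint_odd_cycles C C'.

Definition odd_pairs : {set {set {set {set T}}}} :=
  [set P | [exists C, exists C', disjoint_odd_cycles C C' && (P == [set C; C'])]].

Definition is_bridge_of_pair (P : {set {set {set T}}}) (b : {set T}) : bool :=
  [exists C, exists C', (P == [set C; C']) && is_bridge C C' b].

(* the set of edges contained in the even closed walk of the bridge b in the
   pair P = {C, C'}: it traverses C once, b, C' once, and b back *)
Definition walk_edges (P : {set {set {set T}}}) (b : {set T}) : {set {set T}} :=
  (\bigcup_(C in P) C) :|: [set b].

Local Open Scope ring_scope.

Definition rho (e : {set T}) : T -> rat := fun v => (v \in e)%:R.

Definition in_aff_hull (S : {set {set T}}) (x : T -> rat) : Prop :=
  exists lam : {set T} -> rat,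
    \sum_(e in S) lam e = 1 /\ forall v, x v = \sum_(e in S) lam e * rho e v.

Definition aff_indep (S : {set {set T}}) : Prop :=
  forall lam : {set T} -> rat,
    \sum_(e in S) lam e = 0 ->
    (forall v, \sum_(e in S) lam e * rho e v = 0) ->
    forall e, e \in S -> lam e = 0.

Definition full_dim (S : {set {set T}}) : Prop :=
  forall e, e \in edges -> in_aff_hull S (rho e).

(* lattice simplex conv{rho e | e in S} of normalized volume 1 with respect to the
   lattice Z^d /\ aff(P_G): its vertices are affinely independent and their integer
   affine combinations give every lattice point of aff(P_G) *)
Definition unimodular_simplex (S : {set {set T}}) : Prop :=
  aff_indep S /\
  forall z : T -> int, in_aff_hull edges (fun v => (z v)%:~R) ->
    exists mu : {set T} -> int,
      \sum_(e in S) mu e = 1 /\ forall v, z v = \sum_(e in S) mu e * (v \in e)%:R.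

(* S is (the vertex set of) a cell of the regular subdivision induced by the height
   function w: the lifted points (rho e, w e), e in S, are exactly those lying on a
   lower face, i.e. on the graph of an affine function h <= w *)
Definition lower_cell (w : {set T} -> rat) (S : {set {set T}}) : Prop :=
  S \subset edges /\
  exists (c : T -> rat) (c0 : rat),
    forall e, e \in edges ->
      \sum_v c v * rho e v + c0 <= w e /\
      (e \in S <-> \sum_v c v * rho e v + c0 = w e).

(* P_G has a regular unimodular triangulation: some height function induces a
   regular subdivision all of whose cells are simplices, the maximal ones unimodular *)
Definition has_regular_unimodular_triangulation : Prop :=
  exists w : {set T} -> rat,
    (forall S, lower_cell w S -> aff_indep S) /\
    (forall S, lower_cell w S -> full_dim S -> unimodular_simplex S).

End Graphs.

(* Main.v *)
(* If the heights separate every pair of disjoint odd cycles, i.e. no cell contains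
   the edges of both, then every full-dimensional cell S is unimodular.  Indeed no
   component of the graph S is bipartite, for otherwise a functional equal to 1 and
   -1 on the two sides of that component would vanish on S but not on all edges;
   so each component contains an odd cycle, hence S has a single component, and
   signed sums of edges along walks of S produce all vectors e_u - e_v and 2 e_u,
   which generate the lattice points of even coordinate sum.  To separate the pairs,
   lower the chosen bridges: the even closed walk of the bridge uv of (C, C') shows
   that a cell containing C and C' forces -2 w(uv) <= sum of |w| over C and C'.  The
   heights -3 on the bridges of the (at most two) walks with exactly two further
   bridges, -2 on the other bridges and 0 elsewhere violate this by at least 1, so
   that they may be perturbed generically to make all cells simplices. *)
Require Import Defs.
From mathcomp Require Import all_boot all_order all_algebra.
From mathcomp Require Import ring lra zify.
From Stdlib Require Import Classical.

(** * Odd closed walks and odd cycles *)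

Section Walks.
Set Implicit Arguments. Unset Strict Implicit. Unset Printing Implicit Defensive.
Variables (T : finType).
Implicit Types (e g : rel T) (x y u v : T) (p s : seq T) (S C : {set {set T}}).

(** The bipartite double cover: a path from [(x, false)] to [(x, true)] is an odd closed walk at
    [x]. *)
Definition parity_cover e : rel (T * bool) :=
  fun a b => e a.1 b.1 && (a.2 != b.2).

Lemma parity_cover_sym e : symmetric e -> symmetric (parity_cover e).
Proof. by move=> se a b; rewrite /parity_cover se eq_sym. Qed.

Lemma connect_parity_cover e x y (a b : bool) :
  connect (parity_cover e) (x, a) (y, b) ->
  exists p, [/\ path e x p, last x p = y & odd (size p) = a (+) b].
Proof.
case/connectP=> q; elim: q x a => [|[z c] q IHq] x a /=.
  by move=> _ [-> ->]; exists [::]; rewrite /= addbb.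
case/andP=> /andP[/= exz nac] /IHq{}IHq /IHq[p [zp lp op]].
exists (z :: p); split=> //=; first by rewrite exz.
by rewrite op; case: a c b nac {IHq op} => [] [] [].
Qed.

Lemma not_uniq_split s :
  ~~ uniq s -> exists y p1 p2 p3, s = p1 ++ y :: p2 ++ y :: p3.
Proof.
elim: s => //= y s IHs; rewrite negb_and negbK => /orP[|/IHs].
  by case/splitPr=> p2 p3; exists y, [::], p2, p3.
by case=> z [p1 [p2 [p3 ->]]]; exists z, (y :: p1), p2, p3.
Qed.

(** Strong induction on the length: a repeated vertex cuts the closed walk into two shorter closed
    walks, exactly one of which is odd. *)
Lemma odd_closed_walk_cycle e x p :
    irreflexive e -> path e x p -> last x p = x -> odd (size p) ->
  exists s, [/\ is_cycle_seq e s, odd (size s) & {subset s <= p}].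
Proof.
move=> ie; have [n] := ubnP (size p); elim: n => // n IHn in x p *.
rewrite ltnS => le_n xp lp op.
have [up|] := boolP (uniq p).
  (* An odd length below 3 is 1, and a closed walk of length 1 would be a loop. *)
  exists p; split=> //; rewrite /is_cycle_seq up.
  case: p xp lp op {le_n up} => //= y [|z p] /=; first by move=> /andP[+ _] yx; rewrite yx ie.
  case: p => //= t p /and4P[xy yz zt tp] lp _.
  by rewrite rcons_path yz zt tp /= lp.
case/not_uniq_split=> y [p1 [p2 [p3 Ep]]].
move: xp; rewrite Ep cat_path /= cat_path /= => /and5P[xp1 p1y yp2 p2y yp3].
have lp3 : last y p3 = x by move: lp; rewrite Ep last_cat /= last_cat.
have Es : size p = (size (p1 ++ y :: p3) + size (rcons p2 y))%N.
  by rewrite Ep !size_cat /= size_cat /= size_rcons; lia.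
move: op; rewrite Es oddD; case o1: (odd (size (p1 ++ y :: p3))) => /= o2.
- have [||||s [cs os ss]] := IHn x (p1 ++ y :: p3); rewrite ?o1 //.
  + by apply: leq_trans le_n; rewrite Es size_rcons addnS ltnS leq_addr.
  + by rewrite cat_path /= xp1 p1y.
  + by rewrite last_cat.
  + exists s; split=> // z /ss; rewrite -Ep Ep !(mem_cat, inE).
    by case/or3P=> ->; rewrite ?orbT.
- have [||||s [cs os ss]] := IHn y (rcons p2 y); rewrite ?last_rcons //.
  + by apply: leq_trans le_n; rewrite Es size_cat /= addnS addSn ltnS leq_addl.
  + by rewrite rcons_path yp2.
  + exists s; split=> // z /ss; rewrite mem_rcons !(mem_cat, inE).
    by case/orP=> ->; rewrite ?orbT.
Qed.

(** * Edge sets of walks and cycles *)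

Definition walk_edge_seq x p : seq {set T} := pairmap (fun a b => [set a; b]) x p.

Lemma walk_edge_seq_sub x p A : A \in walk_edge_seq x p -> {subset A <= x :: p}.
Proof.
elim: p x => //= y p IHp x; rewrite inE => /predU1P[-> z|/IHp sA z /sA].
  by rewrite !inE orbA => ->.
by rewrite [in X in _ -> X]inE orbC => ->.
Qed.

Lemma uniq_walk_edge_seq x p : uniq (x :: p) -> uniq (walk_edge_seq x p).
Proof.
elim: p x => //= y p IHp x /andP[xyp /IHp ->]; rewrite andbT.
by apply: contra xyp => /walk_edge_seq_sub -> //; rewrite !inE eqxx.
Qed.

(** The closing edge differs from the first edge because its end [last y p] is off that edge, which
    needs length at least 3, and from the later edges because they avoid [x]. *)
Lemma uniq_cycle_edge_seq x p :
  uniq (x :: p) -> (1 < size p)%N -> uniq (walk_edge_seq x (rcons p x)).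
Proof.
case: p => [|y p] // up sp.
have -> : walk_edge_seq x (rcons (y :: p) x) =
          rcons (walk_edge_seq x (y :: p)) [set last y p; x].
  by rewrite /walk_edge_seq -!cats1 pairmap_cat.
rewrite rcons_uniq (uniq_walk_edge_seq up) andbT.
move: up => /= /and3P[xyp yp _]; rewrite !inE negb_or.
have lx : last y p != x by apply: contra xyp => /eqP <-; exact: mem_last.
apply/andP; split.
  have ly : last y p != y.
    by case: p sp yp {xyp lx} => //= z p _; apply: contra => /eqP <-; exact: mem_last.
  apply/eqP=> /setP/(_ (last y p)); rewrite !inE eqxx /=.
  by rewrite (negPf lx) (negPf ly).
by apply: contra xyp => /walk_edge_seq_sub -> //; rewrite !inE eqxx orbT.
Qed.

Lemma cycle_edges_cons x p :
  cycle_edges (x :: p) = [set A in walk_edge_seq x (rcons p x)].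
Proof.
have zipE y s : zip (belast y s) s = pairmap pair y s.
  by elim: s y => //= z s IHs y; rewrite IHs.
have walkE s y : walk_edge_seq y s = [seq [set z.1; z.2] | z <- pairmap pair y s].
  by elim: s y => //= z s IHs y; rewrite IHs.
apply/setP=> A; rewrite inE walkE /cycle_edges rot1_cons -{1}(belast_rcons x p x) zipE.
by apply/imsetP/mapP=> -[z zs ->]; exists z.
Qed.

Lemma cycle_edges_rot n s : cycle_edges (rot n s) = cycle_edges s.
Proof.
rewrite /cycle_edges rot_rot; set t := rot 1 s.
have st : size s = size t by rewrite size_rot.
suff E : zip (rot n s) (rot n t) =i zip s t.
  by apply/setP=> A; apply/imsetP/imsetP=> -[z zs ->]; exists z; rewrite ?E // -E.
move=> z; rewrite -{2}(cat_take_drop n s) -{2}(cat_take_drop n t) /rot.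
by rewrite !zip_cat ?size_drop ?size_take ?st // !mem_cat orbC.
Qed.

Lemma cycle_vertices_cycle_edges s : cycle_vertices (cycle_edges s) = [set x in s].
Proof.
apply/setP=> x; rewrite inE; apply/bigcupP/idP=> [[A]|xs].
  case: s => [|y s]; first by rewrite /cycle_edges => /imsetP[].
  rewrite cycle_edges_cons inE => /walk_edge_seq_sub sA /sA.
  by rewrite inE mem_rcons orbA inE orbb.
have [i s' Es] := rot_to xs.
have : cycle_edges (x :: s') = cycle_edges s by rewrite -Es cycle_edges_rot.
rewrite cycle_edges_cons => <-; exists [set x; head x (rcons s' x)].
  by rewrite inE; case: s' {Es} => [|y s'] /=; rewrite inE eqxx.
by rewrite !inE eqxx.
Qed.

Lemma odd_cycleP g C :
  reflect (exists s, [/\ is_cycle_seq g s, odd (size s) & C = cycle_edges s])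
          (odd_cycle g C).
Proof.
apply: (iffP existsP) => [[n /existsP[t /and3P[ct on /eqP ->]]]|[s [cs os ->]]].
  by exists t; rewrite size_tuple.
have ss : (size s < #|T|.+1)%N.
  by case/and3P: cs => us _ _; rewrite ltnS -(card_uniqP us) max_card.
by exists (Ordinal ss); apply/existsP; exists (in_tuple s); rewrite cs os eqxx.
Qed.

(** Rotating the cycle lets it start at the end [u] of a bridge; as no edge repeats, sums over the
    walk are sums over [C]. *)
Lemma odd_cycle_at g C u :
    odd_cycle g C -> u \in cycle_vertices C ->
  exists p, [/\ uniq (walk_edge_seq u (rcons p u)), path g u (rcons p u),
     ~~ odd (size p) & C = [set A in walk_edge_seq u (rcons p u)]].
Proof.
case/odd_cycleP=> s [/and3P[us ss cs] os ->].
rewrite cycle_vertices_cycle_edges inE => /rot_to[i p Es].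
exists p; rewrite -cycle_edges_cons -Es cycle_edges_rot.
have sp : size s = (size p).+1 by rewrite -(size_rot i) Es.
split=> //.
- by apply: uniq_cycle_edge_seq; rewrite -?Es ?rot_uniq // -ltnS -sp.
- by rewrite -[path _ _ _]/(cycle g (u :: p)) -Es rot_cycle.
- by rewrite sp in os.
Qed.

Lemma disjoint_odd_cycles_disjoint g C C' :
  disjoint_odd_cycles g C C' -> [disjoint C & C'].
Proof.
case/and3P=> /odd_cycleP[s [_ _ EC]] _ dV.
rewrite -setI_eq0; apply/set0Pn=> -[A /setIP[AC AC']].
have /imsetP[z _ EA] : A \in cycle_edges s by rewrite -EC.
have zA : z.1 \in A by rewrite EA !inE eqxx.
by have /negP[] := disjointFr dV (subsetP (bigcup_sup A AC) z.1 zA);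
  apply: (subsetP (bigcup_sup A AC')).
Qed.

Definition edge_rel S : rel T := fun x y => [set x; y] \in S.

Lemma edge_rel_sym S : symmetric (edge_rel S).
Proof. by move=> x y; rewrite /edge_rel setUC. Qed.

Lemma path_edge_rel S x p :
  path (edge_rel S) x p = all [in S] (walk_edge_seq x p).
Proof. by elim: p x => //= y p IHp x; rewrite IHp. Qed.

Lemma edgesP g A : reflect (exists x y, g x y /\ A = [set x; y]) (A \in edges g).
Proof.
rewrite inE; apply: (iffP existsP) => [[x /existsP[y /andP[gxy /eqP]]]|[x [y [gxy ->]]]].
  by exists x, y.
by exists x; apply/existsP; exists y; rewrite gxy eqxx.
Qed.

Lemma edge_rel_edges g : symmetric g -> irreflexive g -> edge_rel (edges g) =2 g.
Proof.
move=> sg ig x y; apply/edgesP/idP=> [[a [b [gab /setP E]]]|gxy]; last by exists x, y.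
have := E b; have := E a; rewrite !inE !eqxx orbT /=.
case/orP=> /eqP Ea; case/orP=> /eqP Eb; move: gab; rewrite Ea Eb ?ig //.
by rewrite sg.
Qed.

End Walks.

(** * Generic perturbation of heights *)

Section Triangulations.
Set Implicit Arguments. Unset Strict Implicit. Unset Printing Implicit Defensive.
Import Order.TTheory GRing.Theory Num.Theory.
Local Open Scope ring_scope.

Variables (T : finType).
Implicit Types (x y u v : T) (p : seq T) (S C : {set {set T}}) (f w : {set T} -> rat).

(** Among the [size q] distinct candidates [d / (n + 2)] one is not a root, since a nonzero [q] has
    fewer than [size q] roots. *)
Lemma exists_small_nonroot (q : {poly rat}) (d : rat) :
  q != 0 -> 0 < d -> exists t, [/\ 0 < t, t < d & ~~ root q t].
Proof.
move=> q0 d0; pose s := [seq d / n.+2%:R | n <- iota 0 (size q)].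
have us : uniq s.
  rewrite map_inj_uniq ?iota_uniq // => m n /(mulfI (lt0r_neq0 d0)) /invr_inj /eqP.
  by rewrite eqr_nat => /eqP[].
have /allPn[t /mapP[n _ ->] nt] : ~~ all (root q) s.
  apply: contraL (leqnn (size q)) => rs.
  by rewrite -ltnNge; have := max_poly_roots q0 rs us; rewrite size_map size_iota.
exists (d / n.+2%:R); split=> //; first by rewrite divr_gt0 ?ltr0n.
by rewrite ltr_pdivrMr ?ltr0n // ltr_pMr // ltr1n.
Qed.

Definition aff_dependency S (lam : {set T} -> rat) : Prop :=
  [/\ \sum_(A in S) lam A = 0, forall v, \sum_(A in S) lam A * rho A v = 0
    & exists2 A, A \in S & lam A != 0].

Lemma aff_indep_or_dependency S : aff_indep S \/ exists lam, aff_dependency S lam.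
Proof.
case: (classic (exists lam, aff_dependency S lam)) => [|nlam]; [by right | left].
move=> lam l0 l1 A AS; apply/eqP/negPn/negP=> lA.
by apply: nlam; exists lam; split=> //; exists A.
Qed.

(* Moment-curve perturbation: along w0 A + t ^ (rank A + 1), every fixed affine
   dependency evaluates to a nonzero polynomial in t. *)
Lemma generic_heights (g : rel T) w0 (d : rat) : 0 < d ->
  exists2 w, forall A, `|w A - w0 A| < d
    & forall S, lower_cell g w S -> aff_indep S.
Proof.
move=> d0.
have /fin_all_exists[L HL] S : exists lam, aff_indep S \/ aff_dependency S lam.
  by case: (aff_indep_or_dependency S) => [|[lam]]; [exists (fun=> 0); left | exists lam; right].
(* The value at [t] of the dependency fixed for [S], applied to the perturbed heights. The exponents
   are distinct and positive, so [L S A] is itself a coefficient of [q S]. *)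
pose q S := (\sum_(A in S) L S A * w0 A)%:P
            + \sum_(A in S) L S A *: 'X^((enum_rank A).+1).
have qE S t : (q S).[t] = \sum_(A in S) L S A * (w0 A + t ^+ (enum_rank A).+1).
  rewrite !hornerE horner_sum -big_split; apply: eq_bigr => A _ /=.
  by rewrite !hornerE mulrDr.
have q0 S : aff_dependency S (L S) -> q S != 0.
  case=> _ _ [A AS nA]; apply/eqP=> /polyP/(_ (enum_rank A).+1).
  rewrite coefD coefC /= add0r coef0 coef_sum (bigD1 A) //= big1 ?addr0.
    by rewrite coefZ coefXn eqxx mulr1; apply/eqP.
  move=> B /andP[_ nBA]; rewrite coefZ coefXn eqSS (inj_eq val_inj).
  by rewrite (inj_eq enum_rank_inj) eq_sym (negPf nBA) mulr0.
(* One [t] serves all [S] at once; [t < 1] makes every power of [t] at most [t], hence below [d]. *)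
have [] := @exists_small_nonroot (\prod_(S | q S != 0) q S) (Num.min d 1).
- by apply/prodf_neq0.
- by rewrite lt_min d0 ltr01.
move=> t [t0]; rewrite lt_min => /andP[td t1] nt.
exists (fun A => w0 A + t ^+ (enum_rank A).+1) => [A|S [sSg [c [c0 cS]]]].
  rewrite addrC addKr ger0_norm ?exprn_ge0 ?ltW //.
  by apply: le_lt_trans td; rewrite exprS ler_piMr ?exprn_ile1 ?ltW.
case: (HL S) => // dS; case: (dS) => l0 l1 _; case/negP: nt.
rewrite /root horner_prod; apply/prodf_eq0; exists S; first exact: q0.
rewrite qE; apply/eqP.
(* On a cell the heights agree with an affine function, which every affine dependency annihilates;
   so [t] would be a root of [q S]. *)
transitivity (\sum_(A in S) L S A * (\sum_v c v * rho A v + c0)).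
  by apply: eq_bigr => A AS; have [_ [-> //]] := cS A (subsetP sSg A AS).
under eq_bigr do rewrite mulrDr.
rewrite big_split /= -mulr_suml l0 mul0r addr0.
under eq_bigr do rewrite mulr_sumr.
rewrite exchange_big big1 // => v _; under eq_bigr do rewrite mulrCA.
by rewrite -mulr_sumr l1 mulr0.
Qed.

(** * Alternating sums along walks and separation of odd cycles *)

Definition alt_sum (r : seq rat) : rat := foldr (fun a b => a - b) 0 r.

Lemma alt_sum_ge (r : seq rat) : - \sum_(a <- r) `|a| <= alt_sum r.
Proof.
suff: `|alt_sum r| <= \sum_(a <- r) `|a| by rewrite ler_norml => /andP[].
elim: r => [|a r IHr]; first by rewrite big_nil normr0.
by rewrite big_cons (le_trans (ler_normB _ _)) // lerD2l.
Qed.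

(** The sum telescopes; for an odd closed walk at [x] it equals [2 * c x + c0]. *)
Lemma alt_sum_walk (e : rel T) (c : T -> rat) (c0 : rat) f x p :
    (forall u v, e u v -> f [set u; v] = c u + c v + c0) -> path e x p ->
  alt_sum [seq f A | A <- walk_edge_seq x p] =
  c x - (-1) ^+ size p * c (last x p) + (odd (size p))%:R * c0.
Proof.
move=> fE; elim: p x => [|y p IHp] x /=; first by rewrite /alt_sum /= => _; ring.
case/andP=> /fE fxy yp; rewrite /alt_sum /= -/(alt_sum _) fxy IHp // exprS.
by case: (odd _) => /=; ring.
Qed.

Lemma sum_rho2 (h : T -> rat) u v :
  u != v -> \sum_x h x * rho [set u; v] x = h u + h v.
Proof.
move=> uv; rewrite (bigD1 u) // (bigD1 v) 1?eq_sym //= /rho !inE !eqxx orbT !mulr1.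
rewrite big1 ?addr0 // => x /andP[xu xv].
by rewrite !inE (negPf xu) (negPf xv) mulr0.
Qed.

Section Cells.
Variable (g : rel T).
Hypotheses (g_sym : symmetric g) (g_irr : irreflexive g).

Lemma adj_neq u v : g u v -> u != v.
Proof. by apply: contraTneq => ->; rewrite g_irr. Qed.

Lemma edge_rel_sub S u v : S \subset edges g -> edge_rel S u v -> g u v.
Proof. by move=> /subsetP sS /sS; rewrite -[_ \in _]/(edge_rel _ u v) edge_rel_edges. Qed.

(* The closed walk through C, the edge uv and C' writes twice the lifted point of
   uv as an alternating sum of points of C and C'. *)
Lemma cell_disjoint_cycles w S C C' u v :
    lower_cell g w S -> disjoint_odd_cycles g C C' -> C :|: C' \subset S ->
    u \in cycle_vertices C -> v \in cycle_vertices C' -> g u v ->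
  - 2 * w [set u; v] <= \sum_(A in C :|: C') `|w A|.
Proof.
move=> [sS [c [c0 cS]]] dCC' sCS uC vC' guv.
(* Each odd cycle bounds the supporting functional at its own end of the bridge; the two bounds add
   up to one on [c u + c v + c0], which is at most the height of the bridge. *)
have half D x : odd_cycle g D -> x \in cycle_vertices D -> D \subset S ->
    - (2 * c x + c0) <= \sum_(A in D) `|w A|.
  move=> oD xD sDS; have [p [up gp op ED]] := odd_cycle_at oD xD.
  have Dp : path (edge_rel D) x (rcons p x).
    by rewrite path_edge_rel; apply/allP=> A; rewrite ED !inE.
  have wD a b : edge_rel D a b -> w [set a; b] = c a + c b + c0.
    move=> Dab; have abS := subsetP sDS _ Dab.
    have abg := subsetP sS _ abS; have [_ [<- // _]] := cS _ abg.
    by rewrite sum_rho2 // adj_neq // (edge_rel_sub sS).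
  have := alt_sum_ge [seq w A | A <- walk_edge_seq x (rcons p x)].
  rewrite (alt_sum_walk wD Dp) size_rcons last_rcons /= op exprS -signr_odd (negPf op).
  rewrite big_map ED.
  have -> : \sum_(A in [set A in walk_edge_seq x (rcons p x)]) `|w A| =
            \sum_(A <- walk_edge_seq x (rcons p x)) `|w A|.
    by rewrite big_uniq //; apply: eq_bigl => A; rewrite inE.
  by rewrite expr0 /= mulr1n; lra.
have [sC sC'] : C \subset S /\ C' \subset S by apply/andP; rewrite -subUset.
have [oC oC' _] := and3P dCC'.
rewrite (eq_bigl [in [predU C & C']]) => [|A]; last by rewrite !inE.
rewrite bigU ?(disjoint_odd_cycles_disjoint dCC') //=.
have := half _ _ oC uC sC; have := half _ _ oC' vC' sC'.
have [+ _] := cS [set u; v] ltac:(by rewrite -[_ \in _]/(edge_rel _ u v) edge_rel_edges).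
by rewrite sum_rho2 ?adj_neq //; lra.
Qed.

Lemma sum_rho A : A \in edges g -> \sum_v rho A v = 2.
Proof.
case/edgesP=> u [v [guv ->]]; under eq_bigr do rewrite -[rho _ _]mul1r.
by rewrite sum_rho2 // adj_neq.
Qed.

Lemma aff_hull_sum (z : T -> rat) : in_aff_hull (edges g) z -> \sum_v z v = 2.
Proof.
case=> lam [l1 zE]; rewrite (eq_bigr _ (fun v _ => zE v)) exchange_big /=.
under eq_bigr => A Ag do rewrite -mulr_sumr sum_rho //.
by rewrite -mulr_suml l1 mul1r.
Qed.

(** * Connectedness of full-dimensional cells *)

Section FullDimensional.
Hypothesis g_connected : forall x y, connect g x y.
Variables (x0 : T) (p0 : seq T).
Hypotheses (x0p0 : path g x0 p0) (p0_closed : last x0 p0 = x0) (p0_odd : odd (size p0)).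

Lemma alternating_walk (e : rel T) (c : T -> rat) x p :
    (forall u v, e u v -> c u + c v = 0) -> path e x p ->
  c (last x p) = (-1) ^+ size p * c x.
Proof.
move=> ce; elim: p x => [|y p IHp] x /=; first by rewrite mul1r.
case/andP=> /ce cxy /IHp ->; rewrite exprS mulN1r mulNr -mulrN.
by congr (_ * _); lra.
Qed.

(** Going round the odd closed walk gives [c x0 = - c x0]; connectedness spreads the value 0. *)
Lemma alternating_eq0 (c : T -> rat) :
  (forall u v, g u v -> c u + c v = 0) -> forall v, c v = 0.
Proof.
move=> cg v; have := alternating_walk cg x0p0.
rewrite p0_closed -signr_odd p0_odd expr1 => c0.
have /connectP[p x0p ->] := g_connected x0 v.
rewrite (alternating_walk cg x0p); apply/eqP; rewrite mulf_eq0; apply/orP; right.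
by apply/eqP; lra.
Qed.

Variable S : {set {set T}}.
Hypotheses (sSg : S \subset edges g) (S_full : full_dim g S).

Lemma edge_rel_irr : irreflexive (edge_rel S).
Proof.
by move=> x; apply/negP=> /(edge_rel_sub sSg); rewrite g_irr.
Qed.

(* Otherwise the component of x in S is bipartite, and the functional equal to 1
   and -1 on its two sides vanishes on S but not on the whole of edges g. *)
Lemma odd_closed_walk x :
  connect (parity_cover (edge_rel S)) (x, false) (x, true).
Proof.
set R := connect _; have symR := sym_connect_sym (parity_cover_sym (@edge_rel_sym _ S)).
(* The value is 0 outside the component of [x], and also at vertices that walks from [x] reach with
   both parities. *)
pose c v : rat := (R (x, false) (v, false))%:R - (R (x, false) (v, true))%:R.
have cS u v : edge_rel S u v -> c u + c v = 0.
  move=> Suv; have RE a : R (x, false) (v, a) = R (x, false) (u, ~~ a).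
    apply: (same_connect_r symR); apply: connect1; rewrite /parity_cover /=.
    by rewrite edge_rel_sym Suv; case: a.
  by rewrite /c !RE; lra.
have cg u v : g u v -> c u + c v = 0.
  move=> guv; rewrite -sum_rho2 ?adj_neq //.
  have guvE : [set u; v] \in edges g by rewrite -[_ \in _]/(edge_rel _ u v) edge_rel_edges.
  (* The point of [uv] is a combination of points of [S], on all of which the functional [c]
     vanishes. *)
  have [lam [_ lE]] := S_full guvE.
  under eq_bigr do rewrite lE mulr_sumr.
  rewrite exchange_big big1 //= => A AS; under eq_bigr do rewrite mulrCA.
  rewrite -mulr_sumr; have /edgesP[a [b [gab EA]]] := subsetP sSg A AS.
  by rewrite EA sum_rho2 ?adj_neq // cS ?mulr0 // /edge_rel -EA.
have := alternating_eq0 cg x; rewrite /c [R _ (x, false)]connect0.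
by case: (R _ (x, true)) => //= /eqP; rewrite subr0 oner_eq0.
Qed.

Lemma odd_cycle_in_component x :
  exists C, [/\ odd_cycle g C, C \subset S &
    {in cycle_vertices C, forall y, connect (edge_rel S) x y}].
Proof.
have [p [xp lp op]] := connect_parity_cover (odd_closed_walk x).
have [s [cs os ss]] := odd_closed_walk_cycle edge_rel_irr xp lp op.
exists (cycle_edges s); split.
- apply/odd_cycleP; exists s; split=> //; case/and3P: cs => us s2 cs.
  rewrite /is_cycle_seq us s2; apply: sub_cycle cs => u v; exact: edge_rel_sub.
- case/and3P: cs => _ _; case: s {os ss} => [_|y s].
    by apply/subsetP=> A /imsetP[].
  rewrite /cycle path_edge_rel cycle_edges_cons => /allP sS.
  by apply/subsetP=> A; rewrite inE; apply: sS.
- move=> y; rewrite cycle_vertices_cycle_edges inE => /ss yp.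
  have yxp : y \in x :: p by rewrite inE yp orbT.
  exact: path_connect xp _ yxp.
Qed.

(** Odd cycles lying in two different components of [S] would be a disjoint pair inside [S]. *)
Lemma connected_of_no_disjoint_odd_cycles :
    (forall C C', disjoint_odd_cycles g C C' -> ~~ (C :|: C' \subset S)) ->
  forall x y, connect (edge_rel S) x y.
Proof.
move=> nS x y; apply/idPn=> nxy.
have [C [oC CS xC]] := odd_cycle_in_component x.
have [C' [oC' CS' yC']] := odd_cycle_in_component y.
have symS := sym_connect_sym (@edge_rel_sym _ S).
suff dCC' : disjoint_odd_cycles g C C'.
  by case/negP: (nS _ _ dCC'); rewrite subUset CS.
rewrite /disjoint_odd_cycles oC oC' -setI_eq0.
apply/set0Pn=> -[z /setIP[/xC xz /yC']]; rewrite symS => zy.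
by case/negP: nxy; exact: connect_trans xz zy.
Qed.

(** * Integer combinations and unimodularity *)

Definition int_span (z : T -> int) : Prop :=
  exists mu : {set T} -> int, forall v, z v = \sum_(A in S) mu A * (v \in A)%:R.

Lemma int_span_eq (z z' : T -> int) : z =1 z' -> int_span z -> int_span z'.
Proof. by move=> zz' [mu muE]; exists mu => v; rewrite -zz'. Qed.

Lemma int_spanD (z z' : T -> int) :
  int_span z -> int_span z' -> int_span (fun v => z v + z' v).
Proof.
move=> [mu muE] [nu nuE]; exists (fun A => mu A + nu A) => v.
by rewrite muE nuE -big_split; apply: eq_bigr => A _; rewrite mulrDl.
Qed.

Lemma int_spanZ (a : int) (z : T -> int) :
  int_span z -> int_span (fun v => a * z v).
Proof.
move=> [mu muE]; exists (fun A => a * mu A) => v.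
by rewrite muE mulr_sumr; apply: eq_bigr => A _; rewrite mulrA.
Qed.

Lemma int_span_sum (I : finType) (z : I -> T -> int) :
  (forall i, int_span (z i)) -> int_span (fun v => \sum_i z i v).
Proof.
move=> /fin_all_exists[mu muE]; exists (fun A => \sum_i mu i A) => v.
under [RHS]eq_bigr do rewrite mulr_suml.
by rewrite exchange_big; apply: eq_bigr.
Qed.

(** An alternating sum of edge vectors along the walk: the difference of the end vectors for even
    length, their sum for odd length. *)
Lemma int_span_walk x p : path (edge_rel S) x p ->
  int_span (fun v => (v == x)%:R - (-1) ^+ size p * (v == last x p)%:R).
Proof.
elim: p x => [|y p IHp] x /=.
  by move=> _; exists (fun=> 0) => v; rewrite mul1r subrr big1 // => A _; rewrite mul0r.
case/andP=> Sxy /IHp{}IHp.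
have xy : x != y by rewrite adj_neq // (edge_rel_sub sSg).
have Lxy : int_span (fun v => (v == x)%:R + (v == y)%:R).
  exists (fun A => (A == [set x; y])%:R) => v.
  rewrite (bigD1 [set x; y]) //= eqxx mul1r big1 ?addr0 => [|A /andP[_ /negPf->]].
    rewrite !inE; case: (eqVneq v x) => [->|_]; last by rewrite add0r.
    by rewrite (negPf xy) addr0.
  by rewrite mul0r.
apply: int_span_eq (int_spanD Lxy (int_spanZ (-1) IHp)) => v.
by rewrite exprS; ring.
Qed.

(** A lattice point [z] of the affine hull has coordinate sum 2, so it is the sum of the [z u]
    multiples of [e_u - e_x0], plus [2 e_x0]; walks in [S] produce all these vectors. *)
Lemma unimodular_of_connected :
  aff_indep S -> (forall x y, connect (edge_rel S) x y) -> unimodular_simplex g S.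
Proof.
move=> indS conS; split=> // z zg.
have [p [x0p lp op]] := connect_parity_cover (odd_closed_walk x0).
have L2 : int_span (fun v => 2 * (v == x0)%:R).
  apply: int_span_eq (int_span_walk x0p) => v.
  by rewrite lp -signr_odd op; ring.
have Ldiff u : int_span (fun v => (v == u)%:R - (v == x0)%:R).
  have /connectP[q x0q lq] := conS x0 u.
  have := int_span_walk x0q; rewrite -lq -signr_odd; case: (odd _) => /= Lq.
    by apply: int_span_eq (int_spanD Lq (int_spanZ (-1) L2)) => v; ring.
  by apply: int_span_eq (int_spanZ (-1) Lq) => v; ring.
have z2 : \sum_v z v = 2.
  apply/eqP; rewrite -(eqr_int rat); apply/eqP.
  by rewrite rmorph_sum (aff_hull_sum zg).
have [mu muE] : int_span z.
  apply: int_span_eq (int_spanD (int_span_sum (fun u => int_spanZ (z u) (Ldiff u))) L2) => v.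
  under eq_bigr do rewrite mulrBr.
  rewrite sumrB -mulr_suml z2 subrK (bigD1 v) //= eqxx mulr1 big1 ?addr0 // => u.
  by rewrite eq_sym => /negPf->; rewrite mulr0.
(* Every edge vector has coordinate sum 2, so comparing coordinate sums gives [2 * \sum mu = 2]. *)
exists mu; split=> //; apply: (@mulIf _ (2 : int)) => //; rewrite mul1r -[RHS]z2.
rewrite (eq_bigr _ (fun v _ => muE v)) exchange_big mulr_suml /=.
apply: eq_bigr => A AS; rewrite -mulr_sumr; congr (_ * _).
apply/eqP; rewrite -(eqr_int rat) rmorph_sum /=; apply/eqP.
rewrite -[LHS]/(2 : rat) -(sum_rho (subsetP sSg A AS)).
by apply: eq_bigr => v _; rewrite rmorph_nat.
Qed.

End FullDimensional.
End Cells.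

(** * Bridges and the choice of heights *)

Lemma card_setI_excess (I : finType) (A X : {set I}) (i : I) :
  (#|X| <= 2)%N -> i \in X -> i \notin A -> (#|A :&: X| <= 1)%N.
Proof.
move=> X2 iX iA; have sub : A :&: X \subset X :\ i.
  apply/subsetP=> j /setIP[jA jX]; rewrite !inE jX andbT.
  by apply: contraNneq iA => <-.
by apply: leq_trans (subset_leq_card sub) _; move: X2; rewrite (cardsD1 i) iX.
Qed.

(** A pair is unordered, so the bridge may be given for [(C', C)]; swapping its ends restores the
    order. *)
Lemma is_bridge_of_pairP (g : rel T) C C' B :
    symmetric g -> irreflexive g -> is_bridge_of_pair g [set C; C'] B ->
  exists u v, [/\ u \in cycle_vertices C, v \in cycle_vertices C', g u v & B = [set u; v]].
Proof.
move=> sg ig /existsP[D /existsP[D' /andP[/eqP/setP E /andP[Bg]]]].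
case/existsP=> u /existsP[v /and3P[uD vD' /eqP EB]].
have guv : g u v by move: Bg; rewrite EB -[_ \in _]/(edge_rel _ u v) edge_rel_edges.
have := E D; have := E D'; rewrite !inE !eqxx orbT /=.
case/orP=> /eqP ED'; case/orP=> /eqP ED; subst D D'.
- have := E C'; rewrite !inE eqxx orbT orbb => /esym/eqP->.
  by exists u, v.
- by exists v, u; rewrite sg setUC.
- by exists u, v.
- have := E C; rewrite !inE eqxx orbb => /esym/eqP->.
  by exists u, v.
Qed.

Lemma bridge_notin g C C' u v :
    disjoint_odd_cycles g C C' -> u \in cycle_vertices C -> v \in cycle_vertices C' ->
  [set u; v] \notin C :|: C'.
Proof.
case/and3P=> _ _ dCC' uC vC'; apply/negP; case/setUP=> uvC.
- have /(_ v) : {subset [set u; v] <= cycle_vertices C} := subsetP (bigcup_sup _ uvC).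
  by rewrite !inE eqxx orbT (disjointFl dCC' vC') => /(_ isT).
- have /(_ u) : {subset [set u; v] <= cycle_vertices C'} := subsetP (bigcup_sup _ uvC).
  by rewrite !inE eqxx (disjointFr dCC' uC) => /(_ isT).
Qed.

(** The heights are perturbations of [- y]. As [y] is integral, the strict inequality leaves a gap
    of at least 1, which a small perturbation cannot close. *)
Lemma triangulation_of_heights (g : rel T) (y : {set T} -> nat) :
    simple_connected g -> (exists C C', disjoint_odd_cycles g C C') ->
    (forall C C', disjoint_odd_cycles g C C' ->
       exists u v, [/\ u \in cycle_vertices C, v \in cycle_vertices C', g u v
         & (\sum_(A in C :|: C') y A < 2 * y [set u; v])%N]) ->
  has_regular_unimodular_triangulation g.
Proof.
move=> [g_sym g_irr g_con] [C0 [C0' d0]] y_gap.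
pose N : rat := #|{set T}|%:R.
have N0 : 0 <= N by exact: ler0n.
(* At most [N] edges of the cycles and twice the bridge contribute an error of at most
   [(N + 2) / (N + 3) < 1]. *)
have [|w w_near w_indep] := @generic_heights g (fun A => - (y A)%:R) (N + 3)^-1.
  by rewrite invr_gt0; lra.
have w_sep S : lower_cell g w S ->
    forall C C', disjoint_odd_cycles g C C' -> ~~ (C :|: C' \subset S).
  move=> wS C C' dCC'; apply/negP=> sCS.
  have [u [v [uC vC' guv y_lt]]] := y_gap _ _ dCC'.
  have := cell_disjoint_cycles g_sym g_irr wS dCC' sCS uC vC' guv.
  move: y_lt; rewrite -(ler_nat rat) -natr1 natrM natr_sum.
  set d := (N + 3)^-1 in w_near.
  have d_gt0 : 0 < d by rewrite invr_gt0; lra.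
  have dN : N * d + 3 * d = 1 by rewrite -mulrDl mulfV // gt_eqF //; lra.
  have wy A : `|w A| <= (y A)%:R + d.
    rewrite -[w A](subrK (- (y A)%:R)) (le_trans (ler_normD _ _)) //.
    by rewrite normrN normr_nat addrC lerD2l ltW.
  have : \sum_(A in C :|: C') `|w A| <= \sum_(A in C :|: C') (y A)%:R + N * d.
    apply: le_trans (ler_sum _ (fun A _ => wy A)) _; rewrite big_split lerD2l /=.
    by rewrite sumr_const -mulr_natl ler_wpM2r ?(ltW d_gt0) // ler_nat max_card.
  have := w_near [set u; v]; rewrite ltr_norml => /andP[_].
  move=> *; lra.
exists w; split=> // S wS S_full.
have [sSg _] := wS.
(* A cycle of the given disjoint pair serves as the odd closed walk of [g]. *)
have [/odd_cycleP[s [/and3P[_ s2 cs] os _]] _ _] := and3P d0.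
case: s s2 cs os => // x0 p0 _ x0p0 os.
apply: (unimodular_of_connected g_sym g_irr g_con x0p0) => //;
  rewrite ?last_rcons ?size_rcons //; first exact: w_indep.
apply: (connected_of_no_disjoint_odd_cycles g_sym g_irr g_con x0p0) => //;
  rewrite ?last_rcons ?size_rcons //; exact: w_sep.
Qed.

End Triangulations.

Theorem theorem2p1 (T : finType) (g : rel T)
  (Hg : simple_connected g)
  (Hfund : fundamental_FHM g)
  (b : {set {set {set T}}} -> {set T})
  (Hbridge : forall P, P \in odd_pairs g -> is_bridge_of_pair g P (b P))
  (Hat_most_2 : forall P, P \in odd_pairs g ->
     (#| walk_edges P (b P) :&: ((b @: odd_pairs g) :\ b P) | <= 2)%N)
  (Hcount : (#| [set P in odd_pairs g |
       #| walk_edges P (b P) :&: ((b @: odd_pairs g) :\ b P) | == 2%N] | <= 2)%N) :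
  has_regular_unimodular_triangulation g.
Proof.
have [g_sym g_irr g_con] := Hg.
have [_ two_cycles] := Hfund.
set B := b @: odd_pairs g in Hat_most_2 Hcount *.
set Q := [set P in _ | _] in Hcount.
pose X := b @: Q.
have cardX : (#|X| <= 2)%N := leq_trans (leq_imset_card _ _) Hcount.
(* Weight 3 on [X], 2 on the other chosen bridges, 0 elsewhere. *)
pose y A : nat := ((A \in B) * (2 + (A \in X)))%N.
apply: (triangulation_of_heights (y := y)) => // C C' dCC'.
set P := [set C; C'].
have PP : P \in odd_pairs g.
  by rewrite inE; apply/existsP; exists C; apply/existsP; exists C'; rewrite dCC' eqxx.
have bB : b P \in B by apply: imset_f.
have [u [v [uC vC' guv Eb]]] := is_bridge_of_pairP g_sym g_irr (Hbridge P PP).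
exists u, v; split=> //; rewrite -Eb.
have bW : b P \notin C :|: C' by rewrite Eb (bridge_notin dCC').
pose A0 := walk_edges P (b P) :&: (B :\ b P).
(* Only the chosen bridges other than [b P] count, since [b P] lies on neither cycle. *)
have -> : (\sum_(A in C :|: C') y A = #|A0| * 2 + #|A0 :&: X|)%N.
  transitivity (\sum_(A in A0) (2 + (A \in X)))%N.
    rewrite big_mkcond [RHS]big_mkcond; apply: eq_bigr => A _.
    rewrite 2![in RHS]inE /walk_edges bigcup_setU !big_set1 [in RHS]inE in_set1 in_setD1 /y.
    have [->|_] := eqVneq A (b P); first by rewrite (negPf bW) andbF.
    by rewrite [A \in _ :|: _]inE orbF; case: (_ || _); case: (A \in B); rewrite ?mul1n.
  rewrite big_split sum_nat_const -[#|A0 :&: X|]sum1_card; congr (_ + _)%N.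
  rewrite [RHS](eq_bigl (fun A => (A \in A0) && (A \in X))) => [|A]; last exact: in_setI.
  by rewrite [RHS]big_mkcondr; apply: eq_bigr => A _; case: (A \in X).
have A02 : (#|A0| <= 2)%N := Hat_most_2 P PP.
rewrite /y bB mul1n.
have bA0 : b P \notin A0 by rewrite !inE eqxx andbF.
(* With two further bridges [b P] is in [X], which leaves at most one other member of [X]: the sum
   is at most 5 < 6. Otherwise it is at most 3 < 4. *)
have [A0E|A0N] := eqVneq #|A0| 2%N.
  have bX : b P \in X by apply: imset_f; rewrite inE PP; apply/eqP.
  by have := card_setI_excess cardX bX bA0; rewrite bX A0E; set k := #|_|; case: k => [|[|]].
by have := subset_leq_card (subsetIl A0 X); lia.
Qed.
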